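(* Let $\mathbb F_q$ be a finite field, $t,n$ positive integers with $n<\frac{t-1}{2}$, and $d_1>\cdots>d_t\ge 2$ integers not divisible by $\mathrm{char}(\mathbb F_q)$. Let $c_{ji}$ ($1\le i,j\le n$) be positive integers with $c_{j1}+\cdots+c_{jn}<d_t$ for each $j$. Let $A=(a_{ji})\in\mathbb F_q^{n\times t}$ satisfy hypothesis (H), let $a_1,\dots,a_n\in\mathbb F_q$ with $a_j\ne 0$ for some $j$, and $b_1,\dots,b_n\in\mathbb F_q\setminus\{0\}$. Then the number $N$ of solutions in $\mathbb F_q^t$ of the system $$\sum_{i=1}^t a_{ji}X_i^{d_i}+a_j=b_jX_1^{c_{j1}}\cdots X_n^{c_{jn}},\qquad 1\le j\le n,$$ satisfies $\big|N-q^{t-n}\big|\le q^{t/2}(6n d_1)^{t+1}$.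
   Context: Hypothesis (H) on $A\in\mathbb F_q^{n\times t}$: every $n\times n$ submatrix of $A$ (formed by any choice of $n$ columns) has rank $n$. *)

(* Defs.v *)
From HB Require Import structures.
From mathcomp Require Import all_boot all_order all_algebra all_field.
Set Implicit Arguments. Unset Strict Implicit. Unset Printing Implicit Defensive.
Import Order.TTheory GRing.Theory Num.Theory.
Local Open Scope ring_scope.

Definition hypH (F : fieldType) (n t : nat) (A : 'M[F]_(n, t)) : Prop :=
  forall f : 'I_n -> 'I_t, injective f -> \rank (colsub f A) = n.

(* The i-th coordinate (0-based, as a nat) of a point x in F^t;
   used for the variables X_1..X_n (n < t) on the right-hand side. *)
Definition coordn (F : fieldType) (t : nat) (x : {ffun 'I_t -> F}) (i : nat) : F :=
  match @insub nat (fun k => k < t)%N 'I_t i with Some k => x k | None => 0 end.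

(* Main.v *)
Require Import Defs.
From HB Require Import structures.
From mathcomp Require Import all_fingroup all_character.
From mathcomp Require Import all_boot all_order all_algebra all_field.
From mathcomp Require Import zify ring.
Set Implicit Arguments. Unset Strict Implicit. Unset Printing Implicit Defensive.
Import Order.TTheory GRing.Theory Num.Theory.
Local Open Scope ring_scope.

(** Let [psi] be a nontrivial additive character of [F], put [m = t - n] and let
    [Phi] be the part of the system that involves the first [n] variables only.
    Orthogonality gives
      [q^n N = sum_u T(u) prod_(i < m) G_i(lam_i(u))],
    where [T(u) = sum_y psi(u . Phi(y))], [G_i(mu) = sum_z psi(mu z^d_(n+i))] and
    [lam_i(u)] is the [(n+i)]-th entry of [u A]; the term [u = 0] is [q^t].
    The remaining terms are estimated by Cauchy-Schwarz, without any deep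
    exponential sum bound:
    - [sum_u |T(u)|^2 = q^n #{(y, y') : Phi(y) = Phi(y')}], and a fibre of [Phi] has
      at most [prod_(i < n) d_i] points, because after inverting the first [n]
      columns of [A] it is given by equations [y_i^d_i = (lower degree)], so that
      the reduced monomials span all functions on it;
    - [|G_i(mu)|^2 <= d^2 q] for [mu != 0], again by a second moment, while
      [G_i(0) = q]; by (H) the vectors [u] whose combination [u A] vanishes at [k]
      given columns number [q^(n-k)], which exactly compensates the loss.
    The two factors are [q^(2n)] and [q^t] up to constants, so [N - q^m] is
    [O(q^(t/2))]. *)

(** * Additive characters of a finite field *)

Definition additive_character (F : finFieldType) (psi : F -> algC) : Prop :=
  [/\ {morph psi : x y / x + y >-> x * y},
    forall x, `|psi x| = 1 & exists x, psi x != 1].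

(** The additive group is abelian, so its irreducible characters are linear and number |F| > 1; one
    of them is not principal. *)
Lemma exists_additive_character (F : finFieldType) :
  exists psi : F -> algC, additive_character psi.
Proof.
pose G := [set: F]%G.
have abG : abelian G by apply/centsP => x _ y _; apply: addrC.
have lin i : 'chi[G]_i \is a linear_char by apply/char_abelianP.
have ltN : (1 < Nirr G)%N.
  rewrite NirrE; move: (abG); rewrite card_classes_abelian => /eqP ->.
  by rewrite cardsT; exact: card_finNzRing_gt1.
pose i : Iirr G := inord 1%N.
exists 'chi_i; split=> [x y|x|].
- exact: (lin_charM (lin i) (in_setT x) (in_setT y)).
- by have := normC_lin_char (lin i) (in_setT x).
have : i != 0.
  by apply/eqP => /(congr1 val) /=; rewrite inordK // NirrE.
rewrite -irr_eq1 => chi_neq1; apply/existsP; apply: contraNT chi_neq1.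
rewrite negb_exists => /forallP chi1; apply/eqP/cfun_inP => x _.
by rewrite cfun1E in_setT; apply/eqP; rewrite -[_ == _]negbK.
Qed.

(** Translation by [g] permutes the terms and multiplies the sum by [chi g]. *)
Lemma sum_character_eq0 (G : finZmodType) (chi : G -> algC) (g : G) :
  {morph chi : x y / x + y >-> x * y} -> chi g != 1 -> \sum_x chi x = 0.
Proof.
move=> chiD chig; apply/eqP.
have : (chi g - 1) * \sum_x chi x == 0.
  rewrite mulrBl mul1r subr_eq0 mulr_sumr [eqbRHS](reindex_inj (addrI g)) /=.
  by apply/eqP/eq_bigr => x _; rewrite chiD.
by rewrite mulf_eq0 subr_eq0 (negPf chig).
Qed.

(** * Polynomial method for triangular systems *)

(** The functions from [T] to [F] form a space of dimension |T|. The equations reduce all monomials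
    in the y_k to the prod d_i monomials with exponents below the d_i; as the y_k separate points,
    interpolation shows that these span. *)
Lemma card_triangular_system (F : finFieldType) (n : nat) (T : finType)
    (y : 'I_n -> T -> F) (d : 'I_n -> nat) (c : 'I_n -> 'I_n -> nat)
    (M : 'I_n -> 'I_n -> F) (w : 'I_n -> F) :
  (forall s s', (forall k, y k s = y k s') -> s = s') ->
  (forall i j, \sum_k c j k < d i)%N ->
  (forall i, 0 < d i)%N ->
  (forall i s, y i s ^+ d i = \sum_j M i j * (\prod_k y k s ^+ c j k) + w i) ->
  (#|T| <= \prod_i d i)%N.
Proof.
move=> sep ltcd d_gt0 eqy.
pose mono (e : 'I_n -> nat) : {ffun T -> F^o} :=
  [ffun s => \prod_k y k s ^+ e k].
pose E := {dffun forall i, 'I_(d i)}.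
pose U := <<[seq mono (fun k => e k) | e : E]>>%VS.
have monoU e : mono e \in U.
  (* Induction on the total degree: if some exponent reaches [d i], the i-th equation replaces
     y_i^(d_i) by terms of smaller degree, since the c_jk sum over k to less than d_i. *)
  have [N] := ubnP (\sum_k e k); elim: N e => // N IHN e leN.
  have [/forallP lted|] := boolP [forall i, e i < d i]%N.
    apply: memv_span; apply/imageP.
    exists [ffun i => Ordinal (lted i)] => //.
    by apply/ffunP => s; rewrite !ffunE; apply: eq_bigr => k _; rewrite ffunE.
  rewrite negb_forall => /existsP [i]; rewrite -leqNgt => le_de.
  pose e' k := (e k - (k == i) * d i)%N.
  have ee' k : e k = ((k == i) * d i + e' k)%N.
    by rewrite /e' subnKC //; case: eqP => [->|]; rewrite ?mul1n.
  have sum_di : (\sum_k (k == i) * d i)%N = d i.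
    rewrite (bigD1 i) //= eqxx mul1n big1 ?addn0 // => k /negPf -> //.
  have sume : (\sum_k e k = d i + \sum_k e' k)%N.
    by rewrite (eq_bigr _ (fun k _ => ee' k)) big_split /= sum_di.
  have -> : mono e = \sum_j M i j *: mono (fun k => (c j k + e' k)%N)
                     + w i *: mono e'.
    apply/ffunP => s; rewrite !ffunE sum_ffunE.
    under eq_bigr => k _ do rewrite ee' exprD.
    rewrite big_split /= (bigD1 i) //= eqxx mul1n [X in _ * X * _]big1 ?mulr1; last first.
      by move=> k /negPf ->.
    rewrite eqy mulrDl mulr_suml; congr (_ + _); apply: eq_bigr => j _.
    rewrite !ffunE -[in RHS]/(_ * _) -mulrA; congr (_ * _).
    by rewrite -big_split; apply: eq_bigr => k _; rewrite exprD.
  rewrite sume ltnS in leN.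
  apply: memvD; last first.
    by apply/memvZ/IHN; apply: leq_trans leN; rewrite -[X in (X < _)%N]add0n ltn_add2r.
  apply: memv_suml => j _; apply/memvZ/IHN; apply: leq_trans leN.
  by rewrite big_split ltn_add2r.
have mulU k a (f : {ffun T -> F^o}) :
    f \in U -> [ffun s => (y k s - a) * f s] \in U.
  pose X := in_tuple [seq mono (fun k => e k) | e : E].
  move=> fU; rewrite (coord_span (X := X) fU).
  set b := fun i => coord X i f.
  have -> : [ffun s => (y k s - a) * (\sum_i b i *: X`_i : {ffun T -> F^o}) s] =
      \sum_i b i *: ([ffun s => (y k s - a) * (X`_i : {ffun T -> F^o}) s] : {ffun T -> F^o}).
    apply/ffunP => s; rewrite !ffunE !sum_ffunE mulr_sumr.
    by apply: eq_bigr => i _; rewrite !ffunE; apply: mulrCA.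
  apply: memv_suml => i _; apply: memvZ.
  have /imageP[e _ ->] := mem_nth 0 (ltn_ord i).
  have -> : [ffun s => (y k s - a) * mono (fun k => e k) s] =
      mono (fun j => (e j + (j == k))%N) - a *: mono (fun k => e k).
    apply/ffunP => s; rewrite !ffunE mulrBl; congr (_ - _).
    under [in RHS]eq_bigr => j _ do rewrite exprD.
    rewrite big_split mulrC; congr (_ * _).
    rewrite (bigD1 k) //= eqxx big1 ?mulr1 // => j /negPf -> //.
  by rewrite memvB ?memvZ.
have fullU : (fullv <= U)%VS.
  have prodU (l : seq ('I_n * F)) :
      [ffun s => \prod_(p <- l) (y p.1 s - p.2)] \in U.
    elim: l => [|p l /(mulU p.1 p.2)].
      suff -> : [ffun s => \prod_(p <- [::]) (y p.1 s - p.2)] = mono (fun=> 0%N)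
        by exact: monoU.
      by apply/ffunP => s; rewrite !ffunE big_nil big1.
    suff -> : [ffun s => \prod_(i <- p :: l) (y i.1 s - i.2)] =
      [ffun s => (y p.1 s - p.2) * [ffun s' => \prod_(i <- l) (y i.1 s' - i.2)] s]
      by [].
    by apply/ffunP => s; rewrite !ffunE big_cons.
  apply/subvP => f _.
  (* [l s] lists the pairs (k, value) with value different from y_k(s), so the product [g s]
     vanishes exactly away from [s]: a multiple of a Lagrange basis function. *)
  pose l s := [seq p <- enum {: 'I_n * F} | p.2 != y p.1 s].
  pose g s : {ffun T -> F^o} := [ffun s' => \prod_(p <- l s) (y p.1 s' - p.2)].
  have gss s : g s s != 0.
    rewrite ffunE prodf_seq_neq0; apply/allP => p /=.
    by rewrite mem_filter subr_eq0 eq_sym => /andP[].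
  have gs0 s s' : s' != s -> g s s' = 0.
    move=> ne; have [/forallP eqk|] := boolP [forall k, y k s' == y k s].
      by case/eqP: ne; apply: sep => k; apply/eqP.
    rewrite negb_forall => /existsP[k0 nek].
    rewrite ffunE; apply/eqP; rewrite prodf_seq_eq0; apply/hasP.
    by exists (k0, y k0 s'); rewrite /= ?subrr // mem_filter nek mem_enum.
  have -> : f = \sum_s (f s / g s s) *: g s.
    apply/ffunP => s; rewrite sum_ffunE (bigD1 s) //= big1 ?addr0 => [|s' ne].
      by rewrite ffunE -[RHS]/(_ * _) divfK.
    by rewrite ffunE (gs0 s' s) ?scaler0 // eq_sym.
  by apply: rpred_sum => s _; apply/memvZ/prodU.
have : (#|T| <= \dim U)%N.
  by apply: leq_trans (dimvS fullU); rewrite dimvf /dim /= muln1.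
move=> /leq_trans -> //; apply: leq_trans (dim_span _) _.
rewrite size_image card_dep_ffun foldrE big_image /=.
by under eq_bigr => i _ do rewrite card_ord.
Qed.

(** * Orthogonality, second moments and diagonal sums *)

Lemma additive_character0 (F : finFieldType) (psi : F -> algC) :
  additive_character psi -> psi 0 = 1.
Proof.
move=> [psiD psi1 _]; have nz : psi 0 != 0 by rewrite -normr_eq0 psi1 oner_eq0.
by apply: (mulfI nz); rewrite -psiD addr0 mulr1.
Qed.

(** Values have modulus one, so conjugates are inverses. *)
Lemma additive_characterB (F : finFieldType) (psi : F -> algC) x y :
  additive_character psi -> psi (x - y) = psi x * (psi y)^*.
Proof.
move=> psiP; have [psiD psi1 _] := psiP; rewrite psiD; congr (_ * _).
have nz : psi y != 0 by rewrite -normr_eq0 psi1 oner_eq0.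
by apply: (mulfI nz); rewrite -psiD subrr additive_character0 // -normCK psi1 expr1n.
Qed.

Lemma additive_character_sum (F : finFieldType) (psi : F -> algC)
    (I : finType) (f : I -> F) :
  additive_character psi -> psi (\sum_i f i) = \prod_i psi (f i).
Proof.
move=> psiP; have [psiD _ _] := psiP.
exact: (big_morph psi psiD (additive_character0 psiP)).
Qed.

Lemma additive_character_orthogonality (F : finFieldType) (psi : F -> algC)
    (n : nat) (v : 'cV[F]_n) :
  additive_character psi ->
  \sum_(u : 'rV_n) psi ((u *m v) 0 0) = ((v == 0%R) * #|F| ^ n)%N%:R.
Proof.
move=> psiP; have [psiD psi1 [x psix]] := psiP.
case: eqP => [->|/eqP v0]; last first.
  have [i vi] : exists i, v i 0 != 0.
    apply/existsP; apply: contraNT v0; rewrite negb_exists => /forallP v0.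
    apply/eqP/colP => i; rewrite mxE; apply/eqP; rewrite -[_ == _]negbK.
    exact: v0.
  apply: (@sum_character_eq0 _ (fun u : 'rV_n => psi ((u *m v) 0 0))
           ((x / v i 0) *: delta_mx 0 i)) => [u w|].
    by rewrite mulmxDl mxE psiD.
  by rewrite -scalemxAl -rowE !mxE divfK.
under eq_bigr => u _ do rewrite mulmx0 mxE additive_character0 //.
by rewrite sumr_const card_mx mul1n mul1n.
Qed.

(** Expand the square and sum over [u] first: by orthogonality only pairs with equal images survive,
    each with weight q^n. *)
Lemma second_moment (F : finFieldType) (psi : F -> algC) (n : nat)
    (X : finType) (Phi : X -> 'cV[F]_n) :
  additive_character psi ->
  \sum_(u : 'rV_n) `|\sum_x psi ((u *m Phi x) 0 0)| ^+ 2 =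
    (#|F| ^ n * \sum_x #|[set y | Phi y == Phi x]|)%N%:R.
Proof.
move=> psiP.
have dotB (u : 'rV[F]_n) (v w : 'cV_n) : (u *m v) 0 0 - (u *m w) 0 0 = (u *m (v - w)) 0 0.
  by rewrite mulmxBr !mxE.
under [LHS]eq_bigr => u _.
  rewrite normCK rmorph_sum /= big_distrlr /=.
  under eq_bigr => x _ do under eq_bigr => y _ do
    rewrite -additive_characterB // dotB.
  over.
rewrite exchange_big mulnC natrM natr_sum mulr_suml; apply: eq_bigr => x _.
rewrite exchange_big /= -sum1_card natr_sum mulr_suml [RHS]big_mkcond.
apply: eq_bigr => y _ /=.
rewrite additive_character_orthogonality // subr_eq0 inE eq_sym natrM.
by case: eqP => _; rewrite ?mul0r.
Qed.

(* Averaging over the twists [lam * s ^+ d], on which the sum is constant. *)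
Lemma diagonal_sum_bound (F : finFieldType) (psi : F -> algC) (d : nat) (lam : F) :
  additive_character psi -> (0 < d)%N -> lam != 0 ->
  `|\sum_x psi (lam * x ^+ d)| ^+ 2 <= (d ^ 2 * #|F|)%N%:R.
Proof.
move=> psiP d_gt0 lam0; pose G mu := \sum_x psi (mu * x ^+ d).
have q_gt1 : (1 < #|F|)%N := card_finNzRing_gt1 F.
have root_le (v : F) : (#|[set y : F | y ^+ d == v]| <= d)%N.
  have nz : 'X^d - v%:P != 0 :> {poly F} by rewrite -size_poly_eq0 size_XnsubC.
  have := @max_poly_roots _ _ (enum [set y : F | y ^+ d == v]) nz.
  rewrite size_XnsubC // ltnS -cardE; apply; last exact: enum_uniq.
  by apply/allP => y; rewrite mem_enum inE rootE !hornerE subr_eq0.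
have inj_scalar : injective (fun v : F => v%:M : 'cV_1).
  by move=> v v' /(congr1 (fun N : 'M_1 => N 0 0)); rewrite !mxE.
(* Second moment of x -> x^d in dimension one: the fibre of 0 is a point, and the fibre through each
   of the q - 1 other points has at most [d]. *)
have total : \sum_mu `|G mu| ^+ 2 <= (#|F| * (1 + #|F|.-1 * d))%N%:R.
  have := @second_moment _ psi 1 F (fun x => (x ^+ d)%:M) psiP.
  rewrite (reindex (fun mu : F => mu%:M : 'rV_1)) /=; last first.
    by exists (fun u : 'rV_1 => u 0 0) => u _; rewrite ?mxE ?eqxx // -mx11_scalar.
  under eq_bigr => mu _ do under eq_bigr => x _ do
    rewrite -scalar_mxM mxE eqxx mulr1n.
  rewrite expn1 => ->; rewrite ler_nat leq_mul2l; apply/orP; right.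
  rewrite (bigD1 0) //= leq_add //.
    rewrite (_ : [set _ | _] = [set 0]) ?cards1 //; apply/setP => y.
    by rewrite !inE (inj_eq inj_scalar) expr0n eqn0Ngt d_gt0 expf_eq0 d_gt0.
  rewrite -[#|F|.-1](cardC1 (0 : F)) -sum_nat_const leq_sum // => x _.
  apply: leq_trans (root_le (x ^+ d)); rewrite subset_leq_card //.
  by apply/subsetP => y; rewrite !inE => /eqP/inj_scalar ->.
have twist s : s != 0 -> G (lam * s ^+ d) = G lam.
  move=> s0; rewrite /G [RHS](reindex_inj (mulfI s0)) /=.
  by apply: eq_bigr => x _; rewrite exprMn mulrA.
have G0 : G 0 = #|F|%:R.
  rewrite /G; under eq_bigr => x _ do rewrite mul0r additive_character0 //.
  by rewrite sumr_const.
(* The term at mu = 0 is q^2, and q(1 + (q-1)d) - q^2 = q(q-1)(d-1). *)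
have tail : \sum_(mu | mu != 0) `|G mu| ^+ 2 <=
    (#|F| * #|F|.-1 * (d - 1))%N%:R.
  move: total; rewrite (bigD1 0) //= G0 normr_nat -natrX -lerBrDl => /le_trans.
  apply; rewrite lerBlDr -natrD ler_nat.
  case: (#|F|) q_gt1 d_gt0 => // q; case: (d) => //; nia.
(* All q - 1 twists give the same modulus, and each mu is reached by at most [d] of them. With
   [tail] this yields d(d-1)q as a bound. *)
have : #|F|.-1%:R * `|G lam| ^+ 2 <= d%:R * (\sum_(mu | mu != 0) `|G mu| ^+ 2).
  rewrite -[#|F|.-1](cardC1 (0 : F)) mulr_natl -sumr_const.
  rewrite (partition_big (fun s => lam * s ^+ d) (fun mu => mu != 0)) /=; last first.
    by move=> s s0; rewrite mulf_neq0 // expf_neq0.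
  rewrite mulr_sumr; apply: ler_sum => mu mu0.
  rewrite (eq_bigr (fun=> `|G mu| ^+ 2)); last first.
    by move=> s /andP[s0 /eqP <-]; rewrite twist.
  rewrite sumr_const -[leLHS]mulr_natl ler_wpM2r ?exprn_ge0 // ler_nat.
  apply: leq_trans (root_le (mu / lam)); rewrite subset_leq_card //.
  apply/subsetP => s; rewrite !inE => /andP[_ /eqP <-].
  by rewrite [lam * _]mulrC mulfK.
move=> le1; have q1_gt0 : 0 < #|F|.-1%:R :> algC by rewrite ltr0n -subn1 subn_gt0.
rewrite -(ler_pM2l q1_gt0); apply: le_trans le1 _.
apply: le_trans (ler_wpM2l (ler0n _ d) tail) _.
by rewrite -!natrM ler_nat; nia.
Qed.

(** * Zeros of row combinations under (H) *)

(** Complete [W] to [n] columns. By (H) they form an invertible matrix, so the entries there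
    determine [u]; those in [W] are zero and n - |W| remain free. *)
Lemma card_vanishing_combinations (F : finFieldType) (n m : nat) (B : 'M[F]_(n, m))
    (W : {set 'I_m}) :
  hypH B -> (#|W| <= n)%N -> (n <= m)%N ->
  (#|[set u : 'rV[F]_n | [forall i in W, (u *m B) 0%R i == 0%R]]| <= #|F| ^ (n - #|W|))%N.
Proof.
move=> HB Wn nm.
pose s := enum W ++ take (n - #|W|) (enum (~: W)).
have sz : size s = n.
  rewrite size_cat size_take -!cardE; have := cardsC W; rewrite card_ord.
  by case: ifP; lia.
have s_uniq : uniq s.
  rewrite cat_uniq enum_uniq take_uniq ?enum_uniq // andbT.
  apply/hasPn => i /mem_take; rewrite !mem_enum inE => //.
pose f (k : 'I_n) : 'I_m := tnth (Tuple (introT eqP sz)) k.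
have f_inj : injective f by apply/tuple_uniqP.
have f_W (k : 'I_n) : (k < #|W|)%N -> f k \in W.
  move=> kW; have i0 : 'I_m by exact: widen_ord nm k.
  rewrite /f (tnth_nth i0) /= nth_cat -cardE kW -mem_enum mem_nth //.
  by rewrite -cardE.
have lt_n (i : 'I_(n - #|W|)) : (#|W| + i < n)%N by rewrite -ltn_subRL.
pose g (u : 'rV[F]_n) := [ffun i => (u *m B) 0 (f (Ordinal (lt_n i)))].
rewrite -[X in (_ <= _ ^ X)%N]card_ord -card_ffun.
rewrite -(card_in_imset (f := g)) ?max_card // => u v.
rewrite !inE => /forall_inP uW /forall_inP vW guv.
have /row_freeP[C BC] : row_free (colsub f B) by rewrite /row_free HB.
rewrite -[u]mulmx1 -[v]mulmx1 -BC !mulmxA; congr (_ *m _).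
rewrite !mulmx_colsub; apply/rowP => k; rewrite !mxE.
have [kW|Wk] := ltnP k #|W|.
  have := uW _ (f_W k kW); have := vW _ (f_W k kW).
  by rewrite !mxE => /eqP -> /eqP ->.
have lti : (k - #|W| < n - #|W|)%N by rewrite ltn_sub2r // (leq_ltn_trans Wk).
have := congr1 (fun h : {ffun _} => h (Ordinal lti)) guv.
rewrite !ffunE !mxE; suff -> : Ordinal (lt_n (Ordinal lti)) = k by [].
by apply/val_inj; rewrite /= subnKC.
Qed.

(** Group the [u] by zero set W: each group has at most q^(n-|W|) members of weight q^|W|, and there
    are at most 2^m sets W. *)
Lemma sum_expn_card_zeros (F : finFieldType) (n m : nat) (B : 'M[F]_(n, m)) :
  hypH B -> (n <= m)%N ->
  (\sum_(u : 'rV[F]_n | u != 0%R) #|F| ^ #|[set i | (u *m B) 0%R i == 0%R]|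
     <= 2 ^ m * #|F| ^ n)%N.
Proof.
move=> HB nm; pose Z (u : 'rV[F]_n) := [set i | (u *m B) 0 i == 0].
have q_gt0 : (0 < #|F|)%N by apply: ltnW; exact: card_finNzRing_gt1.
have Zlt (u : 'rV[F]_n) : u != 0 -> (#|Z u| < n)%N.
  (* If [n] entries vanished, the preceding bound would allow a single vector, and 0 is one. *)
  move=> u0; rewrite ltnNge; apply: contra u0 => nZ.
  pose W := [set i in take n (enum (Z u))].
  have cW : #|W| = n.
    have /card_uniqP := take_uniq n (enum_uniq (Z u)).
    by rewrite cardsE size_take -cardE => ->; case: ltngtP nZ.
  have := card_vanishing_combinations HB (eq_leq cW) nm.
  rewrite cW subnn expn0 => /card_le1_eqP eq_all.
  apply/eqP; apply: eq_all; rewrite inE; apply/forall_inP => i.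
    by rewrite mul0mx mxE.
  by rewrite inE => /mem_take; rewrite mem_enum inE.
apply: (@leq_trans (\sum_(W : {set 'I_m} | #|W| <= n) #|F| ^ n)%N); last first.
  have card_sets : #|{set 'I_m}| = (2 ^ m)%N.
    by rewrite -cardsT -powersetT card_powerset cardsT card_ord.
  by rewrite sum_nat_const -card_sets leq_mul2r max_card orbT.
rewrite (partition_big Z (fun W => #|W| <= n)%N) /=; last by move=> u /Zlt/ltnW.
apply: leq_sum => W leW; rewrite (eq_bigr (fun=> #|F| ^ #|W|)%N); last first.
  by move=> u /andP[_ /eqP <-].
rewrite sum_nat_const -[X in (_ <= _ ^ X)%N](subnK leW) expnD leq_mul2r; apply/orP; right.
apply: leq_trans (card_vanishing_combinations HB leW nm).
apply/subset_leq_card/subsetP => u; rewrite !inE => /andP[_ /eqP <-].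
by apply/forall_inP => i; rewrite inE.
Qed.

(** * Cauchy-Schwarz and the deviation estimate *)

(** Lagrange's identity: twice the difference of the sides is the double sum of (a_i b_j - a_j
    b_i)^2. *)
Lemma Cauchy_Schwarz_sum (I : finType) (P : pred I) (a b : I -> algC) :
  (forall i, a i \is Num.real) -> (forall i, b i \is Num.real) ->
  (\sum_(i | P i) a i * b i) ^+ 2 <=
  (\sum_(i | P i) a i ^+ 2) * (\sum_(i | P i) b i ^+ 2).
Proof.
move=> aR bR; rewrite -subr_ge0 -(pmulr_lge0 _ (ltr0n _ 2)) mulrBl.
have -> : (\sum_(i | P i) a i ^+ 2) * (\sum_(i | P i) b i ^+ 2) * 2%:R =
   \sum_(i | P i) \sum_(j | P j) (a i ^+ 2 * b j ^+ 2 + a j ^+ 2 * b i ^+ 2).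
  under [RHS]eq_bigr => i _ do rewrite big_split.
  rewrite [RHS]big_split [X in _ = _ + X]exchange_big /= big_distrlr.
  by rewrite mulr_natr mulr2n.
rewrite expr2 big_distrlr /= mulr_suml -sumrB sumr_ge0 // => i _.
rewrite mulr_suml -sumrB sumr_ge0 // => j _.
have -> : a i ^+ 2 * b j ^+ 2 + a j ^+ 2 * b i ^+ 2 - a i * b i * (a j * b j) * 2%:R
  = (a i * b j - a j * b i) ^+ 2.
  rewrite sqrrB !exprMn addrAC mulr_natr; congr (_ - _ *+ 2 + _).
  by rewrite mulrACA [b i * _]mulrC mulrACA.
by rewrite real_exprn_even_ge0 // rpredB ?rpredM.
Qed.

(** Here [X] stands for the first block of variables, [K] bounds the fibres of [Phi] and [D] the
    exponents. Multiplying by q^n and squaring keeps the bound a natural number. *)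
Lemma card_solutions_deviation (F : finFieldType) (n m : nat) (X : finType)
    (Phi : X -> 'cV[F]_n) (B : 'M[F]_(n, m)) (d : 'I_m -> nat) (D K : nat) :
  hypH B -> (n <= m)%N -> (forall i, 0 < d i <= D)%N ->
  (forall v, #|[set x | Phi x == v]| <= K)%N ->
  `|(#|F| ^ n * #|[set p : X * {ffun 'I_m -> F} |
                    Phi p.1 + B *m (\col_i p.2 i ^+ d i) == 0%R]|)%:R
     - (#|X| * #|F| ^ m)%:R : algC| ^+ 2 <=
    (#|X| * K * (2 * D ^ 2) ^ m * #|F| ^ (2 * n + m))%:R.
Proof.
move=> HB nm dP fibre; set N := #|_|; have [psi psiP] := exists_additive_character F.
pose lam (u : 'rV[F]_n) i := (u *m B) 0 i.
pose T (u : 'rV[F]_n) := \sum_x psi ((u *m Phi x) 0 0).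
pose G i mu := \sum_x psi (mu * x ^+ d i).
have psi0 := additive_character0 psiP.
have G0 i : G i 0 = #|F|%:R.
  by rewrite /G; under eq_bigr => x _ do rewrite mul0r psi0; rewrite sumr_const.
(* Orthogonality detects solutions; for fixed [u] the character sum splits into [T u] and one
   diagonal sum per remaining variable. *)
have countE : (#|F| ^ n * N)%:R = \sum_u T u * \prod_i G i (lam u i).
  rewrite mulnC natrM /N -sum1_card natr_sum mulr_suml big_mkcond /=.
  transitivity (\sum_(p : X * {ffun 'I_m -> F}) \sum_(u : 'rV[F]_n)
      psi ((u *m (Phi p.1 + B *m (\col_i p.2 i ^+ d i))) 0 0)).
    apply: eq_bigr => p _; rewrite additive_character_orthogonality // inE.
    by case: eqP => _; rewrite ?mul1r ?mul1n ?mul0n.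
  rewrite exchange_big; apply: eq_bigr => u _.
  rewrite bigA_distr_bigA /= big_distrlr /= pair_bigA /=.
  apply: eq_bigr => p _; case: (psiP) => psiD _ _.
  rewrite mulmxDr mxE psiD; congr (_ * _).
  rewrite mulmxA mxE additive_character_sum //.
  by apply: eq_bigr => i _; rewrite [X in _ * X]mxE.
have -> : (#|F| ^ n * N)%:R - (#|X| * #|F| ^ m)%:R =
    \sum_(u | u != 0) T u * \prod_i G i (lam u i).
  rewrite countE (bigD1 0) //= addrAC [X in X + _](_ : _ = 0) ?add0r //.
  rewrite /T; under [\sum_x _]eq_bigr => x _ do rewrite mul0mx mxE psi0.
  under [\prod_i _]eq_bigr => i _ do rewrite /lam mul0mx mxE G0.
  by rewrite sumr_const prodr_const card_ord natrM natrX subrr.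
have le_norm : `|\sum_(u | u != 0) T u * \prod_i G i (lam u i)| <=
    \sum_(u | u != 0) `|T u| * `|\prod_i G i (lam u i)|.
  by apply: le_trans (ler_norm_sum _ _ _) _; apply: ler_sum => u _; rewrite normrM.
apply: le_trans (lerXn2r 2 _ _ le_norm) _; rewrite ?nnegrE ?sumr_ge0 //.
  by move=> u _; rewrite mulr_ge0.
apply: le_trans (Cauchy_Schwarz_sum _ _ _) _ => [u|u|]; try exact: normr_real.
have sumT : \sum_(u | u != 0) `|T u| ^+ 2 <= (#|F| ^ n * (#|X| * K))%:R.
  apply: (@le_trans _ _ (\sum_u `|T u| ^+ 2)).
    by rewrite [leRHS](bigD1 0) //= lerDr exprn_ge0.
  by rewrite second_moment // ler_nat leq_mul2l -sum_nat_const leq_sum ?orbT.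
(* A factor is q^2 where lam_i(u) = 0 and at most D^2 q elsewhere, so each zero costs at most one
   extra q. *)
have sumG : \sum_(u | u != 0) `|\prod_i G i (lam u i)| ^+ 2 <=
    ((D ^ 2 * #|F|) ^ m * (2 ^ m * #|F| ^ n))%:R.
  apply: (@le_trans _ _ (\sum_(u : 'rV[F]_n | u != 0)
     ((D ^ 2 * #|F|) ^ m * #|F| ^ #|[set i | (u *m B) 0%R i == 0%R]|)%:R)).
    apply: ler_sum => u _.
    rewrite normr_prod -prodrXl -[m in (_ ^ m)%N]card_ord -sum1_card expn_sum.
    rewrite -prod_nat_const [X in (_ * X)%N]big_mkcond -big_split /= natr_prod.
    apply: ler_prod => i _; rewrite exprn_ge0 //= inE -/(lam u i).
    have /andP[di_gt0 di_le] := dP i.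
    case: eqP => [->|/eqP lam0].
      rewrite G0 normr_nat -natrX ler_nat -mulnA mulnn leq_pmull // expn_gt0.
      by rewrite (leq_trans di_gt0 di_le).
    apply: le_trans (diagonal_sum_bound psiP di_gt0 lam0) _.
    by rewrite ler_nat muln1 leq_mul2r leq_exp2r // di_le orbT.
  rewrite -natr_sum ler_nat -big_distrr leq_mul2l sum_expn_card_zeros ?orbT //.
have sqr_sum_ge0 (f : 'rV[F]_n -> algC) : 0 <= \sum_(u | u != 0) `|f u| ^+ 2.
  by rewrite sumr_ge0 // => u _; rewrite exprn_ge0.
apply: le_trans (ler_pM (sqr_sum_ge0 _) (sqr_sum_ge0 _) sumT sumG) _.
rewrite -natrM ler_nat eq_leq // !expnMn expnD mul2n -addnn expnD.
by ring.
Qed.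

(** * Splitting the variables into two blocks *)

Definition join_ffun (F : finType) (n m : nat)
    (p : {ffun 'I_n -> F} * {ffun 'I_m -> F}) : {ffun 'I_(n + m) -> F} :=
  [ffun k => match split k with inl i => p.1 i | inr i => p.2 i end].

Lemma join_ffunl (F : finType) (n m : nat) p (i : 'I_n) :
  @join_ffun F n m p (lshift m i) = p.1 i.
Proof. by rewrite ffunE -[lshift m i]/(unsplit (inl i)) unsplitK. Qed.

Lemma join_ffunr (F : finType) (n m : nat) p (i : 'I_m) :
  @join_ffun F n m p (rshift n i) = p.2 i.
Proof. by rewrite ffunE -[rshift n i]/(unsplit (inr i)) unsplitK. Qed.

Lemma join_ffun_bij (F : finType) (n m : nat) : bijective (@join_ffun F n m).
Proof.
exists (fun x : {ffun 'I_(n + m) -> F} =>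
  ([ffun i => x (lshift m i)], [ffun i => x (rshift n i)])) => [[y z]|x].
  by congr (_, _); apply/ffunP => i; rewrite ffunE (join_ffunl, join_ffunr).
apply/ffunP => k; rewrite -[k]splitK.
by case: (split k) => i; rewrite /= (join_ffunl, join_ffunr) ffunE.
Qed.

(** Multiplying by the inverse of [A] isolates each y_i^(d_i), giving the shape of
    [card_triangular_system]. *)
Lemma card_fiber_triangular (F : finFieldType) (n : nat) (A : 'M[F]_n)
    (a b : 'I_n -> F) (d : 'I_n -> nat) (c : 'I_n -> 'I_n -> nat) (v : 'cV[F]_n) :
  A \in unitmx -> (forall i j, \sum_k c j k < d i)%N -> (forall i, 0 < d i)%N ->
  (#|[set y : {ffun 'I_n -> F} |
      (A *m (\col_i y i ^+ d i) +
       \col_j (a j - b j * \prod_i y i ^+ c j i) == v)%R]|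
    <= \prod_i d i)%N.
Proof.
move=> Aunit ltcd d_gt0; set S := [set y | _].
have <- : #|{: {y | y \in S}}| = #|S| by rewrite card_sig; apply: eq_card.
pose M i j := invmx A i j * b j; pose w i := (invmx A *m (v - \col_j a j)) i 0.
apply: (@card_triangular_system F n _ (fun k (s : {y | y \in S}) => val s k) d c M w) => //.
  by move=> s s' eqs; apply/val_inj/ffunP.
move=> i [y yS] /=; move: (yS); rewrite inE => /eqP eqv.
have -> : y i ^+ d i = (invmx A *m (A *m \col_i y i ^+ d i)) i 0.
  by rewrite mulKmx // mxE.
rewrite (canRL (addrK _) eqv).
have -> : v - \col_j (a j - b j * \prod_i y i ^+ c j i) =
  \col_j (b j * \prod_i y i ^+ c j i) + (v - \col_j a j).
  by apply/colP => j; rewrite !mxE; ring.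
rewrite mulmxDr mxE; congr (_ + _); rewrite mxE; apply: eq_bigr => j _.
by rewrite mxE mulrA.
Qed.

(** * Deviation of N for the given system *)

(* Indices are 0-based: d i (i < t) is d_{i+1}, c j i is c_{j+1,i+1}, etc. *)
Theorem mainTheorem13 (F : finFieldType) (t n : nat)
  (d : nat -> nat) (c : 'I_n -> 'I_n -> nat)
  (A : 'M[F]_(n, t)) (a b : 'I_n -> F) :
  (0 < t)%N -> (0 < n)%N -> (2 * n + 1 < t)%N ->
  (forall i j : nat, (i < j)%N -> (j < t)%N -> (d j < d i)%N) ->
  (2 <= d t.-1)%N ->
  (forall i : nat, (i < t)%N -> forall p : nat, p \in [pchar F] -> ~~ (p %| d i)%N) ->
  (forall j i, 0 < c j i)%N ->
  (forall j, \sum_(i < n) c j i < d t.-1)%N ->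
  hypH A ->
  (exists j, a j != 0) ->
  (forall j, b j != 0) ->
  let N := #|[set x : {ffun 'I_t -> F} | [forall j : 'I_n,
              \sum_(i < t) A j i * x i ^+ d i + a j
                == b j * \prod_(i < n) coordn x i ^+ c j i]]| in
  let q := #|F| in
  `| N%:R - (q ^ (t - n))%:R | <=
     (sqrtC (q%:R : algC)) ^+ t * ((6 * n * d 0%N) ^ t.+1)%N%:R.

Proof.
move=> t_gt0 n_gt0 lt_nt dlt d_ge2 _ _ sumc HA _ _ /=.
have [m tE] : exists m, t = (n + m)%N by exists (t - n)%N; lia.
subst t; cbv zeta; set N := #|[set x | _]|; set q := #|F|.
have nm : (n <= m)%N by lia.
have d_le i : (i < n + m)%N -> (d (n + m).-1 <= d i)%N.
  move=> lti; have [-> //|/eqP ne] := eqVneq i (n + m).-1.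
  by apply/ltnW/dlt; lia.
have d_le0 i : (i < n + m)%N -> (d i <= d 0)%N.
  by case: i => // i lti; apply/ltnW/dlt.
have d_gt0 i : (i < n + m)%N -> (0 < d i)%N.
  by move=> lti; apply: leq_trans (d_le i lti); apply: ltnW.
pose Phi (y : {ffun 'I_n -> F}) : 'cV[F]_n :=
  lsubmx A *m (\col_i y i ^+ d i) + \col_j (a j - b j * \prod_i y i ^+ c j i).
(* Composing injections with the shifts passes (H) to the last [m] columns and makes the first [n]
   columns invertible. *)
have HB : hypH (rsubmx A).
  move=> f f_inj; apply: etrans (HA _ (inj_comp (@rshift_inj n m) f_inj)).
  by congr (\rank _); apply/matrixP => i j; rewrite !mxE.
have Aunit : lsubmx A \in unitmx.
  rewrite -row_free_unit; apply/eqP; apply: etrans (HA _ (@lshift_inj n m)).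
  by congr (\rank _); apply/matrixP => i j; rewrite !mxE.
have fibre v : (#|[set y | Phi y == v]| <= d 0%N ^ n)%N.
  apply: leq_trans (card_fiber_triangular a b v Aunit _ _) _.
  - by move=> i j; apply: leq_trans (sumc j) (d_le _ _); rewrite ltn_addr.
  - by move=> i; rewrite d_gt0 // ltn_addr.
  rewrite -[X in (_ <= _ ^ X)%N]card_ord -prod_nat_const; apply: leq_prod => i _.
  by rewrite d_le0 // ltn_addr.
have cardN : #|[set p : {ffun 'I_n -> F} * {ffun 'I_m -> F} |
    Phi p.1 + rsubmx A *m (\col_i p.2 i ^+ d (n + i)%N) == 0%R]| = N.
  rewrite /N -(on_card_preimset (f := @join_ffun F n m)); last first.
    exact/onW_bij/join_ffun_bij.
  apply: eq_card => p; rewrite !inE.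
  have coordE (i : 'I_n) : coordn (join_ffun p) i = p.1 i.
    rewrite /coordn insubT ?ltn_addr // => lti; rewrite -[RHS](join_ffunl p).
    by congr (join_ffun p _); apply/val_inj.
  have eqE (j : 'I_n) : (Phi p.1 + rsubmx A *m (\col_i p.2 i ^+ d (n + i)%N)) j 0 =
      \sum_(i < n + m) A j i * join_ffun p i ^+ d i + a j
      - b j * \prod_(i < n) coordn (join_ffun p) i ^+ c j i.
    rewrite big_split_ord /=; under [\prod_i _]eq_bigr => i _ do rewrite coordE.
    rewrite (_ : \sum_i A j (lshift m i) * _ = (lsubmx A *m \col_i p.1 i ^+ d i) j 0).
      rewrite (_ : \sum_i A j (rshift n i) * _ =
        (rsubmx A *m \col_i p.2 i ^+ d (n + i)%N) j 0).
        have PhiE : Phi p.1 j 0 = (lsubmx A *m \col_i p.1 i ^+ d i) j 0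
            + (a j - b j * \prod_i p.1 i ^+ c j i).
          by rewrite [LHS]mxE [X in _ + X = _]mxE.
        by rewrite [LHS]mxE PhiE; ring.
      by rewrite mxE; apply: eq_bigr => i _; rewrite !mxE join_ffunr.
    by rewrite mxE; apply: eq_bigr => i _; rewrite !mxE join_ffunl.
  apply/eqP/forallP => [eq0 j|eq0].
    by rewrite -subr_eq0 -eqE eq0 mxE.
  by apply/colP => j; rewrite eqE mxE; apply/eqP; rewrite subr_eq0.
have d'P (i : 'I_m) : (0 < d (n + i) <= d 0)%N.
  by rewrite d_gt0 ?d_le0 // ltn_add2l.
(* Applied with |X| = q^n, K = D^n and D = [d 0]. The goal is then squared and multiplied by q^(2n)
   to match. *)
have := card_solutions_deviation HB nm d'P fibre.
rewrite {}cardN card_ffun card_ord -/q => bound.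
have q_gt0 : (0 < q)%N by apply: ltnW; exact: card_finNzRing_gt1.
rewrite addKn -(@ler_pXn2r _ 2) ?nnegrE ?mulr_ge0 ?exprn_ge0 ?sqrtC_ge0 ?ler0n //.
rewrite exprMn exprAC sqrtCK -!natrX -natrM.
have qn_gt0 : 0 < ((q ^ n) ^ 2)%N%:R :> algC by rewrite ltr0n !expn_gt0 q_gt0.
rewrite -(ler_pM2l qn_gt0) -natrM.
have <- : `|(q ^ n * N)%:R - (q ^ n * q ^ m)%:R : algC| ^+ 2 =
    ((q ^ n) ^ 2)%:R * `|N%:R - (q ^ m)%:R| ^+ 2.
  by rewrite !natrM -mulrBr normrM normr_nat exprMn expr2.
apply: le_trans bound _; rewrite ler_nat.
set D := d 0%N; set E := (6 * n * D)%N.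
have D_gt0 : (0 < D)%N by rewrite d_gt0 // addn_gt0 n_gt0.
have E_gt0 : (0 < E)%N by rewrite !muln_gt0 n_gt0.
have DE : (6 * D <= E)%N by rewrite leq_mul2r leq_pmulr ?orbT.
(* As E >= 6D, both D and 2D^2 are at most E^2, so the constant is at most E^(2(n+m)), within the
   allowed E^(2(n+m+1)). *)
have le1 : (D ^ n <= (E ^ n) ^ 2)%N by rewrite expnAC leq_exp2r //; nia.
have le2 : ((2 * D ^ 2) ^ m <= (E ^ m) ^ 2)%N.
  by rewrite expnAC leq_exp2r ?(leq_trans n_gt0) //; nia.
have le3 : (D ^ n * (2 * D ^ 2) ^ m <= (E ^ (n + m).+1) ^ 2)%N.
  apply: leq_trans (leq_mul le1 le2) _.
  by rewrite -expnMn -expnD leq_exp2r // leq_pexp2l.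
have -> : (q ^ n * D ^ n * (2 * D ^ 2) ^ m * q ^ (2 * n + m) =
    (q ^ n) ^ 2 * q ^ (n + m) * (D ^ n * (2 * D ^ 2) ^ m))%N.
  by rewrite mul2n -addnn !expnD; ring.
by rewrite [leqRHS]mulnA leq_mul2l le3 orbT.
Qed.
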